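(* Consider a network instance $G(\mathcal{V},\mathcal{E})$, $\{c_e\}$, $\{u_e\}$, $\{r_i\}$, $\{\phi_i\}$, $w>0$ as defined in the context, with non-empty set of feasible flows. Suppose the optimization problem $$\begin{aligned} &\underset{\mathbf{x}\in\mathbb{R}^{|\mathcal{E}|}}{\text{minimize}} && (1-w) \sum_{e\in\mathcal{E}} c_e x_e + w\sum_{i\in\mathcal{V}_{\text{s}}} \phi_i\Big(\sum_{e\in\mathcal{E}_i^{\text{out}}} x_e\Big) \\ &\text{subject to} && \sum_{e\in\mathcal{E}_i^{\text{out}}} x_e - \sum_{e\in\mathcal{E}_i^{\text{in}}} x_e = r_i,\quad \forall i\in\mathcal{V}_{\text{s}}, \\ &&& 0\leq x_e \leq u_e,\quad \forall e\in\mathcal{E}, \end{aligned}$$ has a unique optimal solution $\mathbf{x}^\ast$. Then there exists a finite integer $T^\ast$ such that, for any $t\geq T^\ast$, the output $\mathbf{\hat{x}}^t=(\hat{x}_e^t)_{e\in\mathcal{E}}$ of the min-sum algorithm after $t$ iterations, where $\hat{x}_e^t=\operatorname*{arg\,min}_z b_e^t(z)$ is the minimizer of the belief function $b_e^t$ defined in the context, satisfies $\mathbf{\hat{x}}^t=\mathbf{x}^\ast$; that is, $\operatorname*{arg\,min}_z b_e^t(z)=\{x_e^\ast\}$ for every $e\in\mathcal{E}$.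
   Context: Network. $G(\mathcal{V},\mathcal{E})$ is a finite directed graph with $\mathcal{V}=\mathcal{V}_{\text{s}}\cup\mathcal{V}_{\text{d}}$, where $\mathcal{V}_{\text{s}}=\{1,\ldots,n\}$ (source/relay nodes) and $\mathcal{V}_{\text{d}}=\{n+1,\ldots,n+m\}$ (destination nodes); an edge $(i,j)\in\mathcal{E}$ means that node $i$ can transmit directly to node $j$, with $i\neq j$. For $i\in\mathcal{V}$, $\mathcal{E}_i$, $\mathcal{E}_i^{\text{out}}$, $\mathcal{E}_i^{\text{in}}$ denote the sets of all edges incident to $i$, outgoing from $i$, and incoming to $i$, respectively. Each $i\in\mathcal{V}_{\text{s}}$ has a rate $r_i\in\mathbb{N}$ (possibly $0$); each edge $e$ has a capacity $u_e\in\mathbb{N}_{>0}$ and a cost $c_e>0$. A flow is feasible if it satisfies the constraints of the optimization problem in the claim; the set of feasible flows is assumed non-empty. Load penalties. For each $i\in\mathcal{V}_{\text{s}}$, $\phi_i:[0,\infty)\to\mathbb{R}$ is a strictly increasing, piecewise-linear convex function whose breakpoints are integers; $w>0$ is a real parameter. Local functions. For $i\in\mathcal{V}_{\text{s}}$ and $\mathbf{z}\in\mathbb{R}_+^{|\mathcal{E}_i|}$, $\psi_i(\mathbf{z})=0$ if $\sum_{e\in\mathcal{E}_i^{\text{out}}} z_e - \sum_{e\in\mathcal{E}_i^{\text{in}}} z_e = r_i$ and $\psi_i(\mathbf{z})=\infty$ otherwise; $f_i(\mathbf{z}) = \psi_i(\mathbf{z}) + w\,\phi_i\big(\sum_{e\in\mathcal{E}_i^{\text{out}}}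 z_e\big)$. For $i\in\mathcal{V}_{\text{d}}$, $f_i\equiv 0$. For $e\in\mathcal{E}$, $g_e:\mathbb{R}\to\mathbb{R}\cup\{\infty\}$ is $g_e(z)=(1-w)c_e z$ if $0\leq z\leq u_e$, and $g_e(z)=\infty$ otherwise. Min-sum algorithm. Messages are functions $\mathbb{R}_+\to\mathbb{R}\cup\{\infty\}$. Initialize $m_{i\to e}^0(z)=g_e(z)$ for all $i\in\mathcal{V}$, $e\in\mathcal{E}_i$, $z\in\mathbb{R}_+$. For $t\geq 1$, each $i\in\mathcal{V}_{\text{s}}$ and $e\in\mathcal{E}_i$, set $$m_{i\to e}^t(z) = g_e(z) + \min_{\mathbf{\tilde{z}}\in\mathbb{R}_+^{|\mathcal{E}_i|}:\, \tilde{z}_e=z} \Big\{f_i(\mathbf{\tilde{z}}) + \sum_{e'\in\mathcal{E}_i\setminus e} m_{k\to e'}^{t-1}(\tilde{z}_{e'})\Big\},\qquad z\in\mathbb{R}_+,$$ where for each $e'$ the node $k$ is the other endpoint of $e'$ (that is, $e'=(i,k)$ or $e'=(k,i)$). For $i\in\mathcal{V}_{\text{d}}$ the messages are not updated: $m_{i\to e}^t=g_e$ for all $t$. After $t$ iterations, for each $e=(i,j)\in\mathcal{E}$ the belief function is, for $z\in[0,u_e]$, $$b_e^t(z)=m_{i\to e}^t(z)+m_{j\to e}^t(z)-g_e(z),$$ with $b_e^t(z)=\infty$ for $z\notin[0,u_e]$, and the output is the vector of minimizers $\hat{x}_e^t=\operatorname*{arg\,min}_z b_e^t(z)$, $e\in\mathcal{E}$.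 *)

(* Defs.v *)
From HB Require Import structures.
From mathcomp Require Import all_boot all_order all_algebra.
From mathcomp Require Import all_classical all_reals all_analysis.

Set Implicit Arguments.
Unset Strict Implicit.
Unset Printing Implicit Defensive.

Import Order.TTheory GRing.Theory Num.Theory.
Import numFieldNormedType.Exports.

Local Open Scope classical_set_scope.
Local Open Scope ring_scope.

(* [inl i] is the i-th source/relay node, [inr j] the j-th destination. *)
Definition vertex (n m : nat) : Type := ('I_n + 'I_m)%type.
HB.instance Definition _ n m := Finite.on (vertex n m).

Definition edge_of n m (E : {set vertex n m * vertex n m}) : Type :=
  {e : vertex n m * vertex n m | e \in E}.
HB.instance Definition _ n m (E : {set vertex n m * vertex n m}) :=
  Finite.on (edge_of E).

Section Penalty.
Variable R : realType.

(* A penalty lives on [0, +oo[; its values at negative reals are irrelevant and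
   left unconstrained. *)
Definition strictly_increasing_nneg (phi : R -> R) :=
  {in `[0, +oo[ &, {homo phi : x y / x < y}}.

Definition convex_nneg (phi : R -> R) :=
  convex_function (`[0, +oo[%classic : set R^o) phi.

(* Piecewise linear on [0, +oo[ with every breakpoint an integer: affine between
   any two consecutive natural numbers. *)
Definition integer_piecewise_linear (phi : R -> R) :=
  forall k : nat, exists a b : R,
    {in `[k%:R, k.+1%:R], forall x, phi x = a * x + b}.

End Penalty.

Record network (R : realType) := Network {
  nsrc : nat;
  ndst : nat;
  edges : {set vertex nsrc ndst * vertex nsrc ndst};
  edges_loopless : forall e, e \in edges -> e.1 != e.2;
  rate : 'I_nsrc -> nat;
  capacity : edge_of edges -> nat;
  capacity_gt0 : forall e, (0 < capacity e)%N;
  cost : edge_of edges -> R;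
  cost_gt0 : forall e, 0 < cost e;
  penalty : 'I_nsrc -> R -> R;
  penalty_incr : forall i, strictly_increasing_nneg (penalty i);
  penalty_convex : forall i, convex_nneg (penalty i);
  penalty_pwl : forall i, integer_piecewise_linear (penalty i);
  weight : R;
  weight_gt0 : 0 < weight
}.

Section MinSum.
Variables (R : realType) (N : network R).

Notation node := (vertex (nsrc N) (ndst N)).
Notation edge := (edge_of (edges N)).
Notation src_node i := (inl i : node).
Notation w := (weight N).

Definition esrc (e : edge) : node := (val e).1.
Definition edst (e : edge) : node := (val e).2.

Definition out_edges (i : node) : {set edge} := [set e | esrc e == i].
Definition in_edges (i : node) : {set edge} := [set e | edst e == i].
Definition inc_edges (i : node) : {set edge} := out_edges i :|: in_edges i.

(* The endpoint of [e] other than [i], for [e] incident to [i]. *)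
Definition other_end (i : node) (e : edge) : node :=
  if esrc e == i then edst e else esrc e.

Definition outflow (x : {ffun edge -> R}) (i : node) : R :=
  \sum_(e in out_edges i) x e.
Definition inflow (x : {ffun edge -> R}) (i : node) : R :=
  \sum_(e in in_edges i) x e.

Definition feasible (x : {ffun edge -> R}) : Prop :=
  (forall i, outflow x (src_node i) - inflow x (src_node i) = (rate i)%:R) /\
  (forall e, 0 <= x e <= (capacity e)%:R).

Definition objective (x : {ffun edge -> R}) : R :=
  (1 - w) * (\sum_e cost e * x e) +
  w * \sum_i penalty i (outflow x (src_node i)).

Definition optimal (x : {ffun edge -> R}) : Prop :=
  feasible x /\ forall y, feasible y -> objective x <= objective y.

Definition unique_optimal (x : {ffun edge -> R}) : Prop :=
  optimal x /\ forall y, optimal y -> y = x.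

Local Open Scope ereal_scope.

(* The local functions of a node [i] take a vector indexed by all edges, but
   read only its coordinates in [inc_edges i]. *)
Definition psi (i : 'I_(nsrc N)) (z : {ffun edge -> R}) : \bar R :=
  if (outflow z (src_node i) - inflow z (src_node i))%R == (rate i)%:R
  then 0 else +oo.

Definition node_fun (i : node) (z : {ffun edge -> R}) : \bar R :=
  match i with
  | inl k => psi k z + (w * penalty k (outflow z i))%R%:E
  | inr _ => 0
  end.

Definition edge_fun (e : edge) (z : R) : \bar R :=
  if (0 <= z <= (capacity e)%:R)%R then ((1 - w) * cost e * z)%R%:E else +oo.

(* [message t i e] is the message from [i] to [e] at time [t]; it is meaningful
   for [e] incident to [i] and a nonnegative argument.  The vectors [y] range
   over all edges, but the minimized expression depends only on the coordinates
   incident to [i], so that the minimum is over the local vectors at [i].  It is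
   the infimum in the extended reals, hence +oo if no local vector has a finite
   value. *)
Fixpoint message (t : nat) (i : node) (e : edge) (z : R) : \bar R :=
  match t, i with
  | t'.+1, inl _ =>
      edge_fun e z +
      ereal_inf
        [set node_fun i y +
             \sum_(e' in inc_edges i :\ e)
               message t' (other_end i e') e' (y e')
        | y in [set y : {ffun edge -> R} |
                 (forall e', 0 <= y e')%R /\ y e = z]]
  | _, _ => edge_fun e z
  end.

Definition belief (t : nat) (e : edge) (z : R) : \bar R :=
  if (0 <= z <= (capacity e)%:R)%R
  then message t (esrc e) e z + message t (edst e) e z - edge_fun e z
  else +oo.

End MinSum.

Definition argmin (R : realType) (b : R -> \bar R) : set R :=
  [set z | forall y, (b z <= b y)%E].

(* Main.v *)
Require Import Defs.
From mathcomp Require Import all_boot all_order all_algebra.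
From mathcomp Require Import all_classical all_reals all_analysis.
From mathcomp Require Import ring lra.

(* Split each source node into an in-side and an out-side joined by an arc that
   carries its outflow, and merge the destinations into a ground node.  In the
   residual graph of the optimal flow [x], with directional derivatives as arc
   costs, uniqueness makes every simple non-backtracking cycle strictly positive.
   Hence there are potentials with nonnegative reduced costs, and every
   non-backtracking walk that meets a vertex twice has an arc of positive reduced
   cost; so long non-backtracking walks are expensive, and walks from ground to
   ground have positive cost.

   When an edge value deviates from [x e], conservation at a node lets part of the
   deviation be cancelled against deviations further down the computation tree.
   By induction on [t], on each side of [x e] the slope of a message is at least
   any lower bound on the costs of the non-backtracking walks that leave through
   [e] and have length at least [t] or reach the ground.  No message needs to be
   minimized by [x] itself, as it need not be near the leaves of the tree.
   Combining the messages from both ends, the belief strictly increases away from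
   [x e] as soon as [t] is large. *)

Set Implicit Arguments.
Unset Strict Implicit.
Unset Printing Implicit Defensive.

Import Order.TTheory GRing.Theory Num.Theory.
Import numFieldNormedType.Exports.

Local Open Scope classical_set_scope.
Local Open Scope ring_scope.

(** * Walks in a residual graph *)

Lemma uniform_radius (R : realType) (A : finType) (Q : A -> R -> Prop) :
  (forall a, exists2 r : R, 0 < r & forall h, 0 <= h <= r -> Q a h) ->
  exists2 r : R, 0 < r & forall a h, 0 <= h <= r -> Q a h.
Proof.
move=> hQ; have /boolp.choice[f fP] : forall a, exists r : R,
    0 < r /\ forall h, 0 <= h <= r -> Q a h.
  by move=> a; have [r r0 rP] := hQ a; exists r.
exists (\big[Num.min/1]_a f a).
  by apply: lt_bigmin => // a _; case: (fP a).
move=> a h /andP[h0 hle]; apply: (fP a).2; rewrite h0 (le_trans hle)//.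
exact: bigmin_le_cond.
Qed.

Section ResidualGraph.
Variables (R : realType) (V U : finType) (tip : U -> bool -> V) (g0 : V).
Notation arc := (U * bool)%type.
Implicit Types (a b : arc) (p c : seq arc) (v : V).

(* [(u, true)] runs along [u], from [tip u false] to [tip u true], and
   [(u, false)] against it; the orientation [o = false] reads walks backwards. *)
Definition atail (o : bool) a := tip a.1 (a.2 != o).
Definition ahead (o : bool) a := tip a.1 (a.2 == o).

Fixpoint walk v p :=
  if p is a :: p' then (atail true a == v) && walk (ahead true a) p' else true.

Definition follows (o : bool) a b :=
  (ahead o a == atail o b) && (b.1 != a.1).

Lemma ahead_neg o a : ahead (~~ o) a = atail o a.
Proof. by rewrite /ahead /atail; case: a => u [] /=; case: o. Qed.

Lemma walk_cat v p q :
  walk v (p ++ q) = walk v p && walk (last v (map (ahead true) p)) q.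
Proof. by elim: p v => //= a p IH v; rewrite IH andbA. Qed.

Lemma telescope_walk (f : V -> R) v p : walk v p ->
  \sum_(a <- p) (f (ahead true a) - f (atail true a)) =
  f (last v (map (ahead true) p)) - f v.
Proof.
elim: p v => [|a p IH] v /=; first by rewrite big_nil subrr.
by move=> /andP[/eqP <- /IH]; rewrite big_cons => ->; ring.
Qed.

Lemma path_walk a p : path (follows true) a p -> walk (ahead true a) p.
Proof.
by elim: p a => //= b p IH a /andP[/andP[/eqP -> _] /IH ->]; rewrite eqxx.
Qed.

(** The cycle starts at the last position whose vertex the walk meets again. Beyond that position no
    vertex repeats, so the heads on the cycle are distinct. *)
Lemma walk_cycle v p : walk v p -> ~~ uniq (v :: map (ahead true) p) ->
  exists p1 c p2, [/\ p = p1 ++ c ++ p2, c != [::],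
    walk (last v (map (ahead true) p1)) c,
    last (last v (map (ahead true) p1)) (map (ahead true) c) =
      last v (map (ahead true) p1) & uniq (map (ahead true) c)].
Proof.
elim: p v => [|a p IH] v //= /andP[/eqP av wp] nu.
case: (boolP (uniq (ahead true a :: map (ahead true) p))) => up.
  have vin : v \in map (ahead true) (a :: p).
    by apply: contraNT nu => nv; apply/andP; split.
  set k := index v (map (ahead true) (a :: p)).
  have kP : (k < size (map (ahead true) (a :: p)))%N by rewrite index_mem.
  exists [::], (take k.+1 (a :: p)), (drop k.+1 (a :: p)); split => //.
  - by rewrite /= cat_take_drop.
  - rewrite /= av eqxx /=.
    by move: wp; rewrite -{1}(cat_take_drop k p) walk_cat => /andP[].
  - have -> : map (ahead true) (take k.+1 (a :: p)) =
       take k.+1 (map (ahead true) (a :: p)) by rewrite map_take.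
    rewrite (take_nth v) // last_rcons.
    exact: nth_index.
  - by rewrite map_take take_uniq.
have [p1 [c [p2 [-> c0 wc lc uc]]]] := IH _ wp up.
by exists (a :: p1), c, p2.
Qed.

(** A later arc on the element of [a] either equals [a] and repeats its head, or reverses it and
    starts at that head. As it cannot follow [a] directly, the walk then reaches that vertex a
    second time. *)
Lemma simple_uniq_elements a p : path (follows true) a p ->
  uniq (map (ahead true) (a :: p)) -> uniq (map fst (a :: p)).
Proof.
elim: p a => // b p IH a /= /andP[fab fp] /andP[ain ub].
have := IH b fp ub; rewrite /= => -> ; rewrite andbT.
apply/negP; rewrite -[_ :: _]/(map fst (b :: p)) => /mapP [d din ad].
have dna : d.1 != a.1.
  move: din; rewrite inE => /orP[/eqP ->|din]; first by case/andP: fab.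
  have {IH}[q1 [q2 pE]] : exists q1 q2, p = q1 ++ d :: q2.
    by case/splitPr: din => q1 q2; exists q1, q2.
  apply/negP => _; case: (eqVneq d.2 a.2) => da2.
    have dE : d = a by case: d a ad da2 {din fab ain pE} => [? ?] [? ?] /= -> ->.
    by move: ain; rewrite pE dE map_cat /= inE mem_cat inE eqxx !orbT.
  have tda : atail true d = ahead true a.
    rewrite /atail /ahead ad; congr tip.
    by case: d.2 a.2 da2 => [] [].
  have hin : atail true d \in map (ahead true) (b :: p).
    have wbp := path_walk fp; rewrite pE walk_cat /= in wbp.
    case/and3P: wbp => _ /eqP -> _.
    by rewrite pE -cat_cons map_cat mem_cat [map _ (_ :: _)]/= mem_last.
  by move: ain; rewrite -tda -/(map _ (b :: p)) => /negP; apply.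
by rewrite ad eqxx in dna.
Qed.

Variables (avail : pred arc) (s : arc -> R).

Hypothesis cycle_gt0 : forall v c, c != [::] -> walk v c ->
  last v (map (ahead true) c) = v -> all avail c -> uniq (map fst c) ->
  0 < \sum_(a <- c) s a.
Hypothesis back_ge0 : forall u, avail (u, true) -> avail (u, false) ->
  0 <= s (u, true) + s (u, false).

Lemma simple_cycle_ge0 v c : walk v c ->
  last v (map (ahead true) c) = v -> all avail c ->
  uniq (map (ahead true) c) -> 0 <= \sum_(a <- c) s a.
Proof.
case: c => [|a c]; first by rewrite big_nil.
move=> wc lc ac uc.
case: (boolP (path (follows true) a c)) => fac.
  by apply/ltW/(cycle_gt0 _ wc) => //; exact: simple_uniq_elements.
(* a backtracking simple cycle consists of an arc and its reverse *)
have : exists p1 b b' p2, [/\ a :: c = p1 ++ b :: b' :: p2,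
    ahead true b = atail true b' & b'.1 = b.1].
  move: wc fac {lc ac uc}; rewrite [walk _ _]/= => /andP[_].
  elim: c a => //= b c IH a /andP[/eqP ab wc]; rewrite negb_and => /orP[].
    rewrite /follows ab eqxx /= negbK => /eqP ba.
    by exists [::], a, b, c.
  by move=> /(IH _ wc) [p1 [d [d' [p2 [-> e1 e2]]]]]; exists (a :: p1), d, d', p2.
move=> [p1 [b [b' [p2 [E bb' e]]]]]; rewrite E in wc lc ac uc *.
have [b2|b2] := eqVneq b'.2 b.2.
  have b'E : b' = b by case: b b' b2 e {E bb' wc lc ac uc} => [? ?] [? ?] /= -> ->.
  by move: uc; rewrite map_cat cat_uniq /= b'E inE eqxx /= !andbF.
have b'h : ahead true b' = atail true b.
  by rewrite /ahead /atail e; congr tip; case: b'.2 b.2 b2 => [] [].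
(* The head of [b'] is the tail of [b], so an arc before [b] or after [b'] would repeat a head of
   the simple cycle. *)
have p10 : p1 = [::].
  case/lastP: p1 wc uc {E lc ac} => // p1 d.
  rewrite walk_cat map_rcons last_rcons /= => /and4P[_ /eqP tb _ _].
  have hin : ahead true b' \in map (ahead true) (b :: b' :: p2).
    by rewrite !inE eqxx orbT.
  rewrite map_cat cat_uniq => /and3P[_ /hasPn /(_ _ hin) /= + _].
  by rewrite map_rcons mem_rcons inE b'h tb eqxx.
have p20 : p2 = [::].
  case/lastP: p2 wc lc uc {E ac} => // p2 d; rewrite p10 /= => /andP[/eqP <- _].
  rewrite map_rcons last_rcons -b'h => <-.
  by rewrite mem_rcons inE eqxx !andbF.
rewrite p10 p20 big_cat big_nil /= add0r !big_cons big_nil addr0.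
have b'E : b' = (b.1, ~~ b.2).
  case: b b' e b2 {E bb' wc lc ac uc b'h} => u i [u' i'] /= ->.
  by case: i i' => [] [].
move: ac; rewrite p10 /= => /and3P[ab ab' _]; rewrite b'E in ab' *.
case: b ab ab' {bb' e b2 b'h b'E E wc lc uc} => u [] /= h1 h2; first exact: back_ge0.
by rewrite addrC; exact: back_ge0.
Qed.

(** Shortest-path potentials: infima over simple walks with arbitrary start, so that the empty walk
    serves every vertex, then shifted to vanish at [g0]. *)
Lemma exists_potential : exists2 pot : V -> R, pot g0 = 0 &
  forall a, avail a -> 0 <= s a + pot (atail true a) - pot (ahead true a).
Proof.
pose simple v0 p v := [/\ walk v0 p, all avail p,
  uniq (v0 :: map (ahead true) p) & last v0 (map (ahead true) p) = v].
pose S v := [set c : R | exists v0 p, simple v0 p v /\ c = \sum_(a <- p) s a].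
have S0 v : (S v !=set0)%classic by exists 0, v, [::]; split; [split | rewrite big_nil].
have lbS v : has_lbound (S v).
  (* Distinct heads make the arcs of a simple walk distinct, so each arc is counted at most once. *)
  exists (- \sum_a `|s a|) => _ [v0 [p [[_ _ /andP[_ /map_uniq up] _] ->]]].
  rewrite lerNl -sumrN big_uniq//= [leRHS](bigID (mem p))/= -[leLHS]addr0.
  apply: lerD; last exact: sumr_ge0.
  by apply: ler_sum => a _; rewrite -normrN ler_norm.
pose pot v := inf (S v).
suff potP a : avail a -> pot (ahead true a) <= pot (atail true a) + s a.
  exists (fun v => pot v - pot g0) => [|a /potP]; first by rewrite subrr.
  by move=> ?; lra.
move=> aa; rewrite -lerBlDr; apply: lb_le_inf => // _ [v0 [p [[wp ap up lp] ->]]].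
rewrite lerBlDr; set w := ahead true a.
case: (boolP (w \in v0 :: map (ahead true) p)) => win; last first.
  apply: ge_inf => //; exists v0, (rcons p a); split; last first.
    by rewrite -cats1 big_cat big_seq1.
  split; rewrite ?map_rcons ?last_rcons//.
  - by rewrite -cats1 walk_cat wp lp /= eqxx.
  - by rewrite all_rcons aa ap.
  - by rewrite -rcons_cons rcons_uniq win.
(* If [w] already lies on the walk, cut there: the rest together with [a] is a simple cycle of
   nonnegative cost, and the first part is a simple walk to [w]. *)
have [p1 [p2 [pE lp1]]] : exists p1 p2,
    p = p1 ++ p2 /\ last v0 (map (ahead true) p1) = w.
  move: win; rewrite inE => /orP[/eqP ->|win]; first by exists [::], p.
  set k := index w (map (ahead true) p).
  have kP : (k < size (map (ahead true) p))%N by rewrite index_mem.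
  exists (take k.+1 p), (drop k.+1 p); split; first by rewrite cat_take_drop.
  by rewrite map_take (take_nth w) // last_rcons nth_index.
move: wp ap up lp; rewrite pE walk_cat all_cat map_cat last_cat lp1.
move=> /andP[wp1 wp2] /andP[ap1 ap2] up lp.
have le1 : pot w <= \sum_(a <- p1) s a.
  apply: ge_inf => //; exists v0, p1; split => //; split => //.
  by move: up; rewrite -cat_cons cat_uniq => /and3P[].
have : 0 <= \sum_(a <- rcons p2 a) s a.
  apply: (@simple_cycle_ge0 w); rewrite ?map_rcons ?last_rcons//.
  - by rewrite -cats1 walk_cat wp2 lp /= eqxx.
  - by rewrite all_rcons aa ap2.
  - move: up; rewrite -cat_cons cat_uniq => /and3P[_ /hasPn hn u2].
    rewrite rcons_uniq u2 andbT; apply/negP => /hn /negP; apply.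
    by rewrite -/w -lp1 mem_last.
by rewrite -cats1 !big_cat /= big_seq1 => ?; lra.
Qed.

Lemma rev_follows o a p : path (follows (~~ o)) a p ->
  path (follows o) (last a p) (rev (belast a p)).
Proof.
rewrite rev_path; apply: sub_path => b c /andP[/eqP h n].
by rewrite /follows -(ahead_neg o b) h -ahead_neg negbK eqxx eq_sym.
Qed.

Lemma last_rev_belast a p : last (last a p) (rev (belast a p)) = a.
Proof.
by rewrite -[LHS](last_cons a) -rev_rcons -lastI rev_cons last_rcons.
Qed.

(** * Reduced costs along non-backtracking walks *)

Section Reduced.
Variable pot : V -> R.
Definition reduced a := s a + pot (atail true a) - pot (ahead true a).
Hypothesis reduced_ge0 : forall a, avail a -> 0 <= reduced a.

Lemma sum_walk v p : walk v p -> \sum_(a <- p) s a =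
  \sum_(a <- p) reduced a + (pot (last v (map (ahead true) p)) - pot v).
Proof.
move=> wp; rewrite -(telescope_walk pot wp) -big_split /=.
by apply: eq_bigr => a _; rewrite /reduced; ring.
Qed.

(** A repeated vertex would close a cycle with distinct elements. Potentials cancel around it, so
    its cost would be zero, against [cycle_gt0]. *)
Lemma zero_walk_uniq a p : path (follows true) a p -> all avail (a :: p) ->
  all (fun b => reduced b == 0) (a :: p) ->
  uniq (atail true a :: map (ahead true) (a :: p)).
Proof.
move=> fp ap zp; apply/negPn/negP => nu.
have wp : walk (atail true a) (a :: p) by rewrite /= eqxx; exact: path_walk.
have [p1 [c [p2 [E c0 wc lc uc]]]] := walk_cycle wp nu.
have [ac zc] : all avail c /\ all (fun b => reduced b == 0) c.
  by move: ap zp; rewrite E !all_cat => /and3P[_ -> _] /and3P[_ -> _].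
have fc : sorted (follows true) c.
  have : sorted (follows true) (p1 ++ c ++ p2) by rewrite -E.
  by case/cat_sorted2 => _ /cat_sorted2[].
have {}uc : uniq (map fst c).
  by case: c c0 {wc lc ac zc E} uc fc => // b c _ uc fc; exact: simple_uniq_elements.
have := cycle_gt0 c0 wc lc ac uc.
rewrite (sum_walk wc) lc subrr addr0 big_seq big1 ?ltxx// => b bc.
by apply/eqP; exact: (allP zc).
Qed.

Lemma zero_walk_size o a p : path (follows o) a p -> all avail (a :: p) ->
  all (fun b => reduced b == 0) (a :: p) -> ((size p).+1 < #|V|)%N.
Proof.
wlog -> : o a p / o = true => [hw|fp ap zp].
  case: o => [|fp ap zp]; first exact: hw.
  have := hw true (last a p) (rev (belast a p)) erefl (@rev_follows true a p fp).
  by rewrite -!rev_rcons -!lastI !all_rev size_rev size_belast; apply.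
have /card_uniqP := zero_walk_uniq fp ap zp.
by rewrite /= size_map => <-; exact: max_card.
Qed.

Section Gap.
Variable eps : R.
Hypothesis gap : forall a, avail a -> reduced a = 0 \/ eps <= reduced a.

Lemma sum_reduced_ge0 p : all avail p -> 0 <= \sum_(b <- p) reduced b.
Proof.
by move=> ap; rewrite big_seq sumr_ge0// => b /(allP ap); exact: reduced_ge0.
Qed.

Lemma sum_reduced_gap p : all avail p ->
  all (fun b => reduced b == 0) p \/ eps <= \sum_(b <- p) reduced b.
Proof.
elim: p => [|b p IH] /=; first by left.
case/andP=> ab ap; rewrite big_cons.
have [b0|be] := gap ab; last by right; rewrite ler_wpDr// sum_reduced_ge0.
by rewrite b0 eqxx add0r; exact: IH.
Qed.

(** By [zero_walk_size], every block of [#|V|] consecutive arcs contains one of nonzero reduced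
    cost, which contributes at least [eps]. *)
Lemma long_walk k o a p : path (follows o) a p -> all avail p ->
  (k * #|V| <= size p)%N -> k%:R * eps <= \sum_(b <- p) reduced b.
Proof.
elim: k a p => [|k IH] a p fp ap sp; first by rewrite mul0r sum_reduced_ge0.
have V0 : (0 < #|V|)%N by apply/card_gt0P; exists g0.
have sV : (#|V| <= size p)%N by apply: leq_trans sp; rewrite leq_pmull.
move: fp ap; rewrite -{1 2}(cat_take_drop #|V| p) cat_path all_cat.
move=> /andP[f1 f2] /andP[a1 a2].
rewrite -{1}(cat_take_drop #|V| p) big_cat/= -natr1 mulrDl mul1r [leLHS]addrC; apply: lerD.
  have [z1|//] := sum_reduced_gap a1.
  have st : size (take #|V| p) = #|V| by rewrite size_takel.
  move: st f1 a1 z1; case: (take _ _) => [/= V00|b q sq]; first by rewrite -V00 in V0.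
  by move=> /= /andP[_ fq] aq zq; have := zero_walk_size fq aq zq; rewrite -sq ltnn.
apply: (IH _ _ f2 a2); rewrite size_drop leq_subRL// -mulSn.
Qed.

End Gap.

End Reduced.

(** Costs telescope to reduced costs plus end potentials, and the potential of [g0] is zero. Both
    bounds include the arc [a], so the total to beat is [s a] and not [0]. *)
Lemma walk_cost_bounds : exists T : nat, forall t, (T <= t)%N ->
  forall a, avail a -> exists2 B : bool -> R, s a < B true + B false &
  forall o p, path (follows o) a p -> all avail p ->
    (t <= size p)%N \/ ahead o (last a p) = g0 ->
    B o <= \sum_(b <- a :: p) s b.
Proof.
have [pot pot0 potP] := exists_potential.
have [eps eps0 gap] : exists2 eps : R, 0 < eps &
    forall a, avail a -> reduced pot a = 0 \/ eps <= reduced pot a.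
  have [|eps eps0 epsP] := @uniform_radius R arc
    (fun a h => avail a -> reduced pot a = 0 \/ h <= reduced pot a).
    move=> a; case: (boolP (avail a)) => [aa|na]; last by exists 1.
    have := potP a aa; rewrite -/(reduced pot a) le_eqVlt => /orP[/eqP <-|r0].
      by exists 1 => //; left.
    by exists (reduced pot a) => // h /andP[_ hr] _; right.
  by exists eps => // a; apply: epsP; rewrite lexx ltW.
have [C C0 CP] : exists2 C : R, 0 <= C & forall v, `|pot v| <= C.
  exists (\sum_v `|pot v|) => [|v]; first exact: sumr_ge0.
  by rewrite (bigD1 v)//= ler_wpDr// sumr_ge0.
(* Enough blocks to outweigh an end potential, at least [- C], and still leave [eps]. *)
pose k := (Num.truncn ((C + eps) / eps)).+1.
have kP : C + eps <= k%:R * eps.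
  rewrite -ler_pdivrMr// ltW//; apply: truncnS_gt.
exists (k * #|V|)%N => t Tt a aa.
pose good o p := [/\ path (follows o) a p, all avail p, ahead o (last a p) = g0 &
   \sum_(b <- p) reduced pot b = 0].
(* [kappa o] vanishes exactly when the ground can be reached from [a] in orientation [o] at zero
   reduced cost. *)
pose kappa o := if `[< exists p, good o p >] then 0 else eps.
have kappa_ge0 o : 0 <= kappa o by rewrite /kappa; case: ifP => // _; exact: ltW.
(* Reading a walk backwards exchanges tails and heads, which flips the sign of the potential. *)
pose pt o v := if o then pot v else - pot v.
have sE o b : s b = reduced pot b + (pt o (ahead o b) - pt o (atail o b)).
  by rewrite /reduced; case: o; rewrite /pt /ahead /atail; case: b => u [] /=; ring.
have sumE o p : path (follows o) a p -> \sum_(b <- a :: p) s b =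
    reduced pot a + \sum_(b <- p) reduced pot b +
    (pt o (ahead o (last a p)) - pt o (atail o a)).
  elim: p {aa kappa kappa_ge0 good} a => [|b p IH] a /=.
    by rewrite big_seq1 big_nil addr0 => _; exact: sE.
  move=> /andP[/andP[/eqP ab _] /IH]; rewrite big_cons => ->.
  by rewrite big_cons (sE o a) ab; ring.
exists (fun o => reduced pot a - pt o (atail o a) + kappa o) => [|o p fp ap hp].
  have -> : s a = reduced pot a - pot (atail true a) + pot (ahead true a).
    by rewrite /reduced; ring.
  rewrite /pt -[atail false a]ahead_neg /=.
  suff : 0 < reduced pot a + kappa true + kappa false by lra.
  have [ra|ra] := gap a aa; last first.
    by have := kappa_ge0 true; have := kappa_ge0 false; lra.
  rewrite ra add0r.
  have := kappa_ge0 true; have := kappa_ge0 false; rewrite /kappa.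
  case: ifP => [/asboolP [p2 [f2 a2 g2 z2]]|]; case: ifP => [/asboolP [p1 [f1 a1 g1 z1]]|];
    try by move=> *; lra.
  have zz p : all avail p -> \sum_(b <- p) reduced pot b = 0 ->
      all (fun b => reduced pot b == 0) p.
    by move=> ap zp; have [//|] := sum_reduced_gap potP gap ap; rewrite zp leNgt eps0.
  (* If [reduced pot a] and both values of [kappa] vanish, the backward walk reversed, then [a],
     then the forward walk form a zero walk from ground to ground, which meets [g0] twice. *)
  have fq : path (follows true) (last a p2) (rev (belast a p2) ++ p1).
    by rewrite cat_path last_rev_belast f1 andbT; exact: (@rev_follows true).
  have E : last a p2 :: rev (belast a p2) ++ p1 = rev p2 ++ a :: p1.
    by rewrite -cat_cons -rev_rcons -lastI rev_cons -cats1 -catA.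
  have := @zero_walk_uniq pot _ _ fq; rewrite E !all_cat !all_rev /= aa a1 a2 ra eqxx !zz//.
  move=> /(_ isT isT) /andP[/negP + _]; case.
  have -> : atail true (last a p2) = ahead true (last a p1) by rewrite g1 -g2 -ahead_neg.
  by rewrite map_f// mem_cat mem_last orbT.
rewrite (sumE _ _ fp).
suff : kappa o <= \sum_(b <- p) reduced pot b + pt o (ahead o (last a p)) by lra.
have sp0 := sum_reduced_ge0 potP ap.
have [hlong|hg] := hp.
  have := long_walk potP gap fp ap (leq_trans Tt hlong).
  have : - C <= pt o (ahead o (last a p)).
    have := CP (ahead o (last a p)); rewrite ler_norml => /andP[? ?].
    by rewrite /pt; case: ifP => _; lra.
  have : kappa o <= eps by rewrite /kappa; case: ifP => // _; exact: ltW.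
  lra.
have -> : pt o (ahead o (last a p)) = 0.
  by rewrite hg /pt pot0 oppr0 if_same.
rewrite addr0 /kappa; case: ifP => // /asboolP hn.
have [z|//] := sum_reduced_gap potP gap ap; case: hn; exists p; split => //.
by rewrite big_seq big1// => b bp; apply/eqP; exact: (allP z).
Qed.

End ResidualGraph.

(** * Slopes of the penalties *)

Definition sg {R : realType} (sigma : bool) : R := if sigma then 1 else -1.

Section Slope.
Variable R : realType.
Implicit Types (phi : R -> R) (a h c : R).

(** [c] is the one-sided derivative at [a]. The exact first clause serves to push flow around a
    cycle; the global second one bounds what is saved by moving a deviating value back toward
    [a]. *)
Definition directional_slope phi a (sigma : bool) c :=
  (exists2 r : R, 0 < r &
     forall h, 0 <= h <= r -> phi (a + sg sigma * h) = phi a + c * h) /\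
  (forall h' h, 0 <= h' <= h -> 0 <= a + sg sigma * h ->
     phi (a + sg sigma * h') + c * (h - h') <= phi (a + sg sigma * h)).

Lemma convex_nneg_line phi a h t : convex_nneg phi -> 0 <= a -> 0 <= a + h ->
  0 <= t <= 1 -> phi (a + t * h) <= (1 - t) * phi a + t * phi (a + h).
Proof.
move=> cphi a0 h0 /andP[t0 t1].
have : phi (t * (a + h) + (1 - t) * a) <= t * phi (a + h) + (1 - t) * phi a.
  by apply: (cphi (Itv01 t0 t1)); rewrite inE /= in_itv /= andbT.
have -> : t * (a + h) + (1 - t) * a = a + t * h by ring.
by move=> H; rewrite [leRHS]addrC.
Qed.

Lemma exists_slope phi a sigma : convex_nneg phi -> integer_piecewise_linear phi ->
  0 <= a -> sigma || (0 < a) -> exists c, directional_slope phi a sigma c.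
Proof.
move=> cphi lphi a0 sa.
have [r r0 [c ra cP]] : exists2 r : R, 0 < r & exists2 c,
    0 <= a + sg sigma * r &
    forall h, 0 <= h <= r -> phi (a + sg sigma * h) = phi a + c * h.
  have /andP[kl ku] := truncn_itv a0; set k := Num.truncn a in kl ku.
  have piece j : j%:R <= a <= j.+1%:R -> exists c,
      forall h, j%:R <= a + sg sigma * h <= j.+1%:R ->
        phi (a + sg sigma * h) = phi a + c * h.
    move=> aj; have [p [q pq]] := lphi j; exists (p * sg sigma) => h hj.
    by rewrite !pq ?in_itv//=; ring.
  case: sigma sa piece => /= sa piece.
    have [|c cP] := piece k; first by rewrite kl ltW.
    exists (k.+1%:R - a); first by rewrite subr_gt0.
    exists c; first by rewrite mul1r; lra.
    by move=> h /andP[h0 hk]; rewrite -[1]/(sg true) cP// /sg mul1r; lra.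
  (* Leftwards the affine piece must end at or beyond [a] and start strictly before it; for an
     integer [a] this is the preceding piece. *)
  have [j ja aj] : exists2 j : nat, j%:R < a & a <= j.+1%:R.
    move: kl; rewrite le_eqVlt => /orP[/eqP ka|ka]; last first.
      by exists k => //; exact: ltW.
    exists k.-1; first by rewrite -ka ltr_nat prednK// -(ltr0n R) ka.
    by rewrite prednK ?ka// -(ltr0n R) ka.
  have [|c cP] := piece j; first by rewrite ltW.
  exists (a - j%:R); first by rewrite subr_gt0.
  have j0 : 0 <= j%:R :> R by [].
  exists c; first by lra.
  by move=> h /andP[h0 hk]; rewrite -[-1]/(sg false) cP// /sg; lra.
exists c; split; first by exists r.
(* Convexity is applied at the distance [m], which is within the affine piece and not beyond [h]. *)
have above h : 0 <= h -> 0 <= a + sg sigma * h -> phi a + c * h <= phi (a + sg sigma * h).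
  rewrite le_eqVlt => /orP[/eqP <-|h0] ah; first by rewrite !mulr0 !addr0.
  pose m := Num.min r h; have m0 : 0 < m by rewrite lt_min r0.
  have [mr mh] : m <= r /\ m <= h by split; rewrite ge_min lexx ?orbT.
  have t0 : 0 <= m / h <= 1 by rewrite ler_pdivrMr// mul1r mh andbT divr_ge0// ltW.
  have := convex_nneg_line cphi a0 ah t0.
  have -> : m / h * (sg sigma * h) = sg sigma * m by field; rewrite gt_eqF.
  rewrite cP ?(ltW m0)// => H.
  suff : 0 <= m / h * (phi (a + sg sigma * h) - (phi a + c * h)).
    by rewrite pmulr_rge0 ?subr_ge0// divr_gt0.
  have -> : m / h * (phi (a + sg sigma * h) - (phi a + c * h)) =
    m / h * phi (a + sg sigma * h) - m / h * phi a - c * m.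
    by field; rewrite gt_eqF.
  by lra.
move=> h' h /andP[h'0 h'h] ah.
have := above h (le_trans h'0 h'h) ah; set D := phi (a + sg sigma * h) => ab.
have [h0|h0] := eqVneq h 0.
  have h'E : h' = h by lra.
  by rewrite h'E subrr mulr0 addr0.
have {}h0 : 0 < h by rewrite lt_neqAle eq_sym h0 (le_trans h'0).
have t0 : 0 <= h' / h <= 1 by rewrite ler_pdivrMr// mul1r h'h andbT divr_ge0// ltW.
have := convex_nneg_line cphi a0 ah t0; rewrite -/D.
have -> : h' / h * (sg sigma * h) = sg sigma * h' by field; rewrite gt_eqF.
move=> H; suff : 0 <= (1 - h' / h) * (D - (phi a + c * h)).
  have -> : (1 - h' / h) * (D - (phi a + c * h)) =
    D - ((1 - h' / h) * phi a + h' / h * D) - c * (h - h').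
    by field; rewrite gt_eqF.
  by lra.
by rewrite mulr_ge0 ?subr_ge0//; case/andP: t0.
Qed.

(** Convexity at the midpoint [a] of two points at distance [m], each on the affine piece of its
    side. *)
Lemma slope_sum_ge0 phi a c c' : convex_nneg phi -> 0 < a ->
  directional_slope phi a true c -> directional_slope phi a false c' ->
  0 <= c + c'.
Proof.
move=> cphi a0 [[r r0 rP] _] [[r' r'0 r'P] _].
pose m := Num.min a (Num.min r r'); have m0 : 0 < m by rewrite !lt_min a0 r0.
have [ma mr mr'] : [/\ m <= a, m <= r & m <= r'].
  by split; rewrite !ge_min lexx ?orbT.
have t0 : 0 <= (2^-1 : R) <= 1 by lra.
have am : 0 <= a - m by lra.
have am' : 0 <= a - m + 2 * m by lra.
have := convex_nneg_line cphi am am' t0.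
have -> : a - m + 2^-1 * (2 * m) = a by field.
have -> : a - m + 2 * m = a + sg true * m by rewrite /sg; ring.
have -> : a - m = a + sg false * m by rewrite /sg; ring.
rewrite rP ?(ltW m0)// r'P ?(ltW m0)// => H.
have : 0 <= (c + c') * m by lra.
by rewrite pmulr_lge0.
Qed.

End Slope.

(** * The residual graph of the optimal flow *)

Section SplitGraph.
Variables (R : realType) (N : network R).
Notation edge := (edge_of (edges N)).
Notation flow := {ffun edge -> R}.
Notation w := (weight N).
Implicit Types (e : edge) (k : 'I_(nsrc N)) (b c sigma : bool) (y : flow).

(* Every source node [k] is split into an in-side [Some (k, false)] and an
   out-side [Some (k, true)] joined by an arc [inr k] carrying the whole outflow
   of [k], and all destinations are merged into [None]; the objective becomes
   separable over the arcs. *)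
Definition split_node := option ('I_(nsrc N) * bool).
Definition split_arc := (edge + 'I_(nsrc N))%type.

Definition junction (i : vertex (nsrc N) (ndst N)) b : split_node :=
  if i is inl k then Some (k, b) else None.

Definition endn e b := if b then esrc e else edst e.

(** The end [b] of an edge attaches to the side [b] of its node, with [true] for source and
    out-side. In [tip], [c = true] means the head, hence the negations. *)
Definition tip (u : split_arc) c : split_node :=
  match u with
  | inl e => junction (endn e (~~ c)) (~~ c)
  | inr k => Some (k, c)
  end.

Definition side b i : {set edge} := if b then out_edges i else in_edges i.

Lemma mem_side b i e : (e \in side b i) = (endn e b == i).
Proof. by case: b; rewrite inE. Qed.

Definition through y k := outflow y (inl k).

Lemma balance y k : feasible y ->
  \sum_(e in side true (inl k)) y e - \sum_(e in side false (inl k)) y e =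
  (rate k)%:R.
Proof. by move=> [h _]; exact: h. Qed.

Lemma through_ge0 y k : (forall e, 0 <= y e) -> 0 <= through y k.
Proof. by move=> y0; apply: sumr_ge0. Qed.

Variable x : flow.
Hypothesis x_opt : unique_optimal x.

Lemma x_feasible : feasible x.
Proof. by case: x_opt => -[]. Qed.

Lemma x_ge0 e : 0 <= x e.
Proof. by case: x_feasible => _ /(_ e) /andP[]. Qed.

Definition avail (a : split_arc * bool) : bool :=
  match a with
  | (inl e, true) => x e < (capacity e)%:R
  | (inl e, false) => 0 < x e
  | (inr k, sigma) => sigma || (0 < through x k)
  end.

Variable dphi : 'I_(nsrc N) -> bool -> R.
Hypothesis dphiP : forall k sigma, avail (inr k, sigma) ->
  directional_slope (penalty k) (through x k) sigma (dphi k sigma).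

Definition slope (a : split_arc * bool) : R :=
  match a with
  | (inl e, sigma) => sg sigma * ((1 - w) * cost e)
  | (inr k, sigma) => w * dphi k sigma
  end.

Definition gain (u : split_arc) (h : R) : R :=
  match u with
  | inl e => (1 - w) * cost e * h
  | inr k => w * (penalty k (through x k + h) - penalty k (through x k))
  end.

Lemma slope_back_ge0 (u : split_arc) : avail (u, true) -> avail (u, false) ->
  0 <= slope (u, true) + slope (u, false).
Proof.
case: u => [e|k] /= _ x0; first by rewrite /sg; lra.
rewrite -mulrDr mulr_ge0 ?(ltW (weight_gt0 N))//.
by apply: (slope_sum_ge0 (penalty_convex k) x0); exact: dphiP.
Qed.

Lemma exists_step : exists2 eps : R, 0 < eps & forall a, avail a ->
  gain a.1 (sg a.2 * eps) = slope a * eps /\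
  (if a.1 is inl e then 0 <= x e + sg a.2 * eps <= (capacity e)%:R else True).
Proof.
have [|eps eps0 epsP] := @uniform_radius R (split_arc * bool)%type
    (fun a h => avail a -> gain a.1 (sg a.2 * h) = slope a * h /\
      (if a.1 is inl e then 0 <= x e + sg a.2 * h <= (capacity e)%:R else True)).
  move=> [u sigma]; case: (boolP (avail (u, sigma))) => [av|_]; last by exists 1.
  case: u av => [e|k] av /=; last first.
    have [[r r0 rP] _] := dphiP av; exists r => // h /rP -> _; split => //; ring.
  have [_ /(_ e) /andP[xe0 xeu]] := x_feasible.
  exists (if sigma then (capacity e)%:R - x e else x e).
    by case: sigma av => /=; rewrite ?subr_gt0.
  move=> h /andP[h0 hr] _; split; first by ring.
  by case: sigma av hr; rewrite /sg /= => av hr; lra.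
by exists eps => // a; apply: epsP; rewrite lexx ltW.
Qed.

Lemma objective_gain y (d : split_arc -> R) :
  (forall e, y e = x e + d (inl e)) ->
  (forall k, through y k = through x k + d (inr k)) ->
  objective y = objective x + \sum_u gain u (d u).
Proof.
move=> ye yk; rewrite /objective big_sumType /=.
have -> : \sum_e cost e * y e = \sum_e cost e * x e + \sum_e cost e * d (inl e).
  by rewrite -big_split; apply: eq_bigr => e _; rewrite ye mulrDr.
have -> : \sum_e (1 - w) * cost e * d (inl e) =
    (1 - w) * \sum_e cost e * d (inl e).
  by rewrite mulr_sumr; apply: eq_bigr => e _; rewrite mulrA.
rewrite -mulr_sumr sumrB.
under [in LHS]eq_bigr => k _ do rewrite -/(through y k) yk.
by rewrite /through; ring.
Qed.

(** The indicator of the split node [(k, b)] telescopes to zero around the closed walk, and the arcs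
    at that node are the edges on side [b] of [k] and the arc [inr k]. *)
Lemma closed_walk_conservation v (c : seq (split_arc * bool))
    (d : split_arc -> R) k b :
  walk tip v c -> last v (map (ahead tip true) c) = v ->
  (forall u, d u = \sum_(a <- c) (a.1 == u)%:R * sg a.2) ->
  \sum_(e in side b (inl k)) d (inl e) = d (inr k).
Proof.
move=> wc lc dE.
have : \sum_u d u * ((tip u true == Some (k, b))%:R - (tip u false == Some (k, b))%:R) = 0.
  under eq_bigr => u _ do rewrite dE mulr_suml.
  rewrite exchange_big /=.
  have := telescope_walk (fun v' => (v' == Some (k, b))%:R : R) wc.
  rewrite lc subrr => E; rewrite -[RHS]E; apply: eq_bigr => -[u sigma] _.
  rewrite (bigD1 u)//= eqxx big1 ?addr0 => [|u' /negPf u'u]; last first.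
    by rewrite eq_sym u'u !mul0r.
  by rewrite /ahead /atail; case: sigma => /=; rewrite /sg /=; ring.
rewrite big_sumType /= (bigD1 k) //= [X in _ + (_ + X)]big1 ?addr0; last first.
  move=> k' /negPf k'k.
  by rewrite !(inj_eq Some_inj) !xpair_eqE k'k /= subrr mulr0.
have jE i c' : (junction i c' == Some (k, b)) = (i == inl k) && (if b then c' else ~~ c').
  case: i => [k'|j] //=; rewrite (inj_eq Some_inj) xpair_eqE.
  by case: c'; case: b.
under eq_bigr => e _ do rewrite !jE /=.
rewrite !(inj_eq Some_inj) !xpair_eqE eqxx /=.
rewrite (big_mkcond (fun e => e \in side b _)) /= => H.
under eq_bigr => e _ do rewrite mem_side.
move: H {jE}; case: b => /=; rewrite ?subr0 ?sub0r ?mulr1 ?mulrN1 => /eqP.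
  rewrite addr_eq0 => /eqP H; rewrite -[RHS]opprK -H -sumrN.
  by apply: eq_bigr => e _; rewrite andbT andbF /=; case: ifP => _ /=; ring.
rewrite subr_eq0 => /eqP <-.
by apply: eq_bigr => e _; rewrite andbT andbF /=; case: ifP => _ /=; ring.
Qed.

Lemma sum_uniq_elements (F : split_arc * bool -> R) (c : seq (split_arc * bool)) a :
  uniq (map fst c) -> a \in c -> \sum_(b <- c) (b.1 == a.1)%:R * F b = F a.
Proof.
elim: c => //= b c IH /andP[bc uc]; rewrite inE big_cons => /orP[/eqP ->|ac].
  rewrite eqxx mul1r big_seq big1 ?addr0// => d dc.
  case: eqP => [db|_]; last by rewrite mul0r.
  by rewrite -db map_f in bc.
have /negPf -> : b.1 != a.1 by apply: contraNneq bc => ->; exact: map_f.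
by rewrite mul0r add0r IH.
Qed.

(** Pushing [eps] around the cycle gives a feasible flow [y] other than [x], whose objective differs
    by [eps] times the cost of the cycle. A cost at most zero would make [y] a second optimum. *)
Lemma residual_cycle_gt0 v (c : seq (split_arc * bool)) :
  c != [::] -> walk tip v c -> last v (map (ahead tip true) c) = v ->
  all avail c -> uniq (map fst c) -> 0 < \sum_(a <- c) slope a.
Proof.
move=> c0 wc lc ac uc; have [eps eps0 epsP] := exists_step.
pose d u : R := \sum_(a <- c) (a.1 == u)%:R * sg a.2.
have dP a : a \in c -> d a.1 = sg a.2 by move=> ain; rewrite /d (sum_uniq_elements _ uc ain).
have d0 u : u \notin map fst c -> d u = 0.
  move=> uin; rewrite /d big_seq big1// => a ain.
  case: eqP => [ua|_]; last by rewrite mul0r.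
    by rewrite -ua map_f in uin.
have cons k b : \sum_(e in side b (inl k)) d (inl e) = d (inr k).
  exact: closed_walk_conservation wc lc _.
pose y : flow := [ffun e => x e + d (inl e) * eps].
have yside b k : \sum_(e in side b (inl k)) y e =
    \sum_(e in side b (inl k)) x e + d (inr k) * eps.
  rewrite -(cons k b) mulr_suml -big_split.
  by apply: eq_bigr => e _; rewrite ffunE.
have yF : feasible y.
  split=> [k|e].
    rewrite -(balance k x_feasible) -[outflow _ _]/(\sum_(e in side true (inl k)) y e).
    by rewrite -[inflow _ _]/(\sum_(e in side false (inl k)) y e) !yside; ring.
  rewrite ffunE; case: (boolP (inl e \in map fst c)) => [/mapP[[u sigma] ain /= eu]|/d0 ->].
    have := dP _ ain; rewrite /= -eu => ->; rewrite -eu in ain.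
    by case: (epsP _ (allP ac _ ain)).
  by rewrite mul0r addr0; case: x_feasible.
have objE : objective y = objective x + eps * \sum_(a <- c) slope a.
  rewrite (@objective_gain y (fun u => d u * eps)); first last.
  - by move=> k; exact: yside true k.
  - by move=> e; rewrite ffunE.
  congr (_ + _).
  have -> : eps * \sum_(a <- c) slope a =
     \sum_u \sum_(a <- c) (a.1 == u)%:R * (slope a * eps).
    rewrite exchange_big mulr_sumr; apply: eq_bigr => a _ /=.
    rewrite (bigD1 a.1)//= eqxx big1 ?addr0 => [|u /negPf ua].
      by rewrite mul1r mulrC.
    by rewrite eq_sym ua mul0r.
  apply: eq_bigr => u _.
  case: (boolP (u \in map fst c)) => [/mapP[a ain ->]|uin].
    rewrite (sum_uniq_elements (fun a => slope a * eps) uc ain) dP//.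
    by case: (epsP _ (allP ac _ ain)).
  rewrite d0// mul0r big_seq big1 => [|a ain]; last first.
    case: eqP => [ua|_]; last by rewrite mul0r.
    by rewrite -ua map_f in uin.
  by case: u {uin} => [e|k] /=; rewrite ?mulr0// addr0 subrr mulr0.
(* If no edge value changed, conservation would leave the throughputs unchanged too, whereas every
   arc of the cycle carries a change of [1] or [-1]. *)
have ynx : y <> x.
  move=> yx; have de e : d (inl e) = 0.
    have /eqP := congr1 (fun f : flow => f e) yx.
    by rewrite ffunE -subr_eq0 addrC addKr mulf_eq0 (gt_eqF eps0) orbF => /eqP.
  have du u : d u = 0.
    by case: u => [e|k]; rewrite ?de// -(cons k true) big1.
  have [a ain] : exists a, a \in c.
    by case: (c) c0 => // a c' _; exists a; rewrite inE eqxx.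
  by have := dP a ain; rewrite du /sg; case: ifP => _ /eqP;
    rewrite eq_sym ?oppr_eq0 oner_eq0.
rewrite -(pmulr_rgt0 _ eps0) -subr_gt0 subr0.
have [[xF xO] xU] := x_opt.
rewrite -(ltrDl (objective x)) -objE ltNge; apply/negP => yx.
by apply: ynx; apply: xU; split => // z zF; exact: le_trans yx (xO _ zF).
Qed.


(** * Edges at a node and the sharing of a deviation *)

Lemma other_endE b i e : e \in side b i -> other_end i e = endn e (~~ b).
Proof.
rewrite mem_side /other_end; case: b => /= /eqP <-; first by rewrite eqxx.
by rewrite (negPf (edges_loopless (valP e))).
Qed.

Lemma side_disjoint b i e : e \in side b i -> e \notin side (~~ b) i.
Proof.
rewrite !mem_side; case: b => /= /eqP <-; last exact: (edges_loopless (valP e)).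
by rewrite eq_sym; exact: (edges_loopless (valP e)).
Qed.

Lemma inc_sides b i e : e \in side b i ->
  inc_edges i :\ e = (side b i :\ e) :|: side (~~ b) i.
Proof.
move=> eb; have /negPf enb := side_disjoint eb.
have -> : inc_edges i = side b i :|: side (~~ b) i.
  by case: b {eb enb} => //; rewrite finset.setUC.
by rewrite finset.setDUl [X in _ :|: X](finset.setDidPl _)// disjoint_sym disjoints1 enb.
Qed.

Lemma sum_inc (T : Type) (idx : T) (op : Monoid.com_law idx) (F : edge -> T) b i e :
  e \in side b i ->
  \big[op/idx]_(f in inc_edges i :\ e) F f =
  op (\big[op/idx]_(f in side b i :\ e) F f) (\big[op/idx]_(f in side (~~ b) i) F f).
Proof.
move=> eb; rewrite (inc_sides eb) -bigU /=.
  by apply: eq_bigl => f; rewrite !inE.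
rewrite disjoint_subset; apply/fintype.subsetP => f; rewrite in_setD1 => /andP[_ fb].
by rewrite inE; exact: side_disjoint fb.
Qed.

(** All positive parts are scaled by the single factor [delta / W], at most [1] because they add up
    to [W]. *)
Lemma split_amount (I : finType) (A : {set I}) (qm : R) (q : I -> R) (delta : R) :
  0 <= delta -> delta <= qm + \sum_(i in A) q i ->
  exists am (a : I -> R), [/\ 0 <= am <= Num.max qm 0,
    forall i, 0 <= a i <= Num.max (q i) 0 & am + \sum_(i in A) a i = delta].
Proof.
move=> d0 dq; pose W := Num.max qm 0 + \sum_(i in A) Num.max (q i) 0.
have max0 (r : R) : 0 <= Num.max r 0 by rewrite le_max lexx orbT.
have dW : delta <= W.
  apply: le_trans dq _; apply: lerD; first by rewrite le_max lexx.
  by apply: ler_sum => i _; rewrite le_max lexx.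
have [d00|dn0] := eqVneq delta 0.
  exists 0, (fun=> 0); split=> [|i|]; rewrite ?lexx ?max0//.
  by rewrite big1 ?addr0 ?d00.
have W0 : 0 < W by apply: lt_le_trans dW; rewrite lt_neqAle eq_sym dn0.
have t0 : 0 <= delta / W by rewrite divr_ge0// ltW.
have t1 : delta / W <= 1 by rewrite ler_pdivrMr// mul1r.
exists (delta / W * Num.max qm 0), (fun i => delta / W * Num.max (q i) 0); split.
- by rewrite mulr_ge0//= ler_piMl.
- by move=> i; rewrite mulr_ge0//= ler_piMl.
- by rewrite -mulr_sumr -mulrDr -/W divfK// gt_eqF.
Qed.

(** * Messages *)

Definition balanced y k := outflow y (inl k) - inflow y (inl k) == (rate k)%:R.

(* The deviation [sg sigma * (y e - x e)] on an edge [e] at side [b] of [k] is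
   compensated by opposite deviations on that side and by the deviation of the
   throughput, which is in turn compensated on the other side; so an amount of it
   can be cancelled along with these. *)
Lemma redistribute k e b sigma y z' (tau := fun f => sigma (+) (f \in side b (inl k))) :
  e \in side b (inl k) -> (forall f, 0 <= y f) -> balanced y k ->
  0 <= sg sigma * (z' - x e) -> 0 <= sg sigma * (y e - z') ->
  exists y' kappa am,
   [/\ y' e = z', forall f, 0 <= y' f,
       through y' k = through y k - sg sigma * am & balanced y' k] /\
   [/\ 0 <= am <= Num.max (sg sigma * (through y k - through x k)) 0,
       forall f, f \in inc_edges (inl k) :\ e ->
         y' f = y f - sg (tau f) * kappa f /\
         0 <= kappa f <= Num.max (sg (tau f) * (y f - x f)) 0,
       \sum_(f in side b (inl k) :\ e) kappa f = sg sigma * (y e - z') - am &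
       \sum_(f in side (~~ b) (inl k)) kappa f = am].
Proof.
move=> eb y0 /eqP ybal zx yz.
set delta := sg sigma * (y e - z').
pose D f := sg sigma * (y f - x f).
pose Dm := sg sigma * (through y k - through x k).
(* Both flows are balanced at [k], so they deviate by the same total on either side. *)
have sumD c : \sum_(f in side c (inl k)) D f = Dm.
  rewrite -mulr_sumr sumrB /Dm; congr (_ * _).
  case: c => //; have := balance k x_feasible; rewrite -ybal /through /outflow /inflow /=.
  by move=> ?; lra.
have splitD (F : edge -> R) : \sum_(f in side b (inl k)) F f =
    F e + \sum_(f in side b (inl k) :\ e) F f by rewrite (big_setD1 e).
(* By [sumD], [D e] is [Dm] minus the other deviations on its side, and [delta] is at most [D e]
   because [z'] lies between [x e] and [y e]. *)
have [|am [al [am0 al0 alE]]] 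
    := @split_amount _ (side b (inl k) :\ e) Dm (fun f => - D f) delta yz.
  rewrite sumrN -(sumD b) splitD /D /delta.
  have := zx; lra.
have [am1 am2] := andP am0.
have [be [be0 beE]] : exists be : edge -> R,
    (forall f, 0 <= be f <= Num.max (D f) 0) /\
    \sum_(f in side (~~ b) (inl k)) be f = am.
  have [am00|amn0] := eqVneq am 0.
    exists (fun=> 0); split=> [f|]; last by rewrite big1.
    by rewrite lexx le_max lexx orbT.
  (* The separate share is not wanted here: its bound [0] forces [bm = 0]. *)
  have [|bm [be [bm0 be0 beE]]] := @split_amount _ (side (~~ b) (inl k)) 0 D am am1.
    rewrite add0r sumD; move: am2; rewrite le_max => /orP[//|am_le0].
    by move: amn0; rewrite eq_le am_le0 am1.
  exists be; split=> //; move: bm0; rewrite maxxx => bm0; rewrite -beE.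
  have -> : bm = 0 by apply/eqP; rewrite eq_le andbC.
  by rewrite add0r.
pose kappa f := if f \in side b (inl k) then al f else be f.
pose y' : flow := [ffun f => if f == e then z' else
  if f \in inc_edges (inl k) then y f - sg (tau f) * kappa f else y f].
have y'e : y' e = z' by rewrite ffunE eqxx.
have y'b f : f \in side b (inl k) :\ e -> y' f = y f + sg sigma * al f.
  rewrite in_setD1 => /andP[/negPf fe fb]; rewrite ffunE fe /kappa /tau fb addbT.
  have -> : f \in inc_edges (inl k).
    by rewrite !inE; case: (b) fb; rewrite inE => ->; rewrite ?orbT.
  by rewrite /sg; case: (sigma) => /=; ring.
have y'nb f : f \in side (~~ b) (inl k) -> y' f = y f - sg sigma * be f.
  move=> fb; have := side_disjoint fb; rewrite negbK => /negPf fnb.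
  have /negPf fe : f != e by apply: contraFneq fnb => ->.
  rewrite ffunE fe /kappa /tau fnb addbF.
  have -> // : f \in inc_edges (inl k).
  by rewrite !inE; case: (b) fb; rewrite inE => ->; rewrite ?orbT.
have kapP f : 0 <= kappa f <= Num.max (sg (tau f) * (y f - x f)) 0.
  rewrite /kappa /tau; case: ifP => _; last by rewrite addbF; exact: be0.
  have -> : sg (sigma (+) true) * (y f - x f) = - D f.
    by rewrite /D /sg addbT; case: (sigma) => /=; ring.
  exact: al0.
have sumb : \sum_(f in side b (inl k)) y' f = \sum_(f in side b (inl k)) y f - sg sigma * am.
  rewrite (big_setD1 e eb)/= [in RHS](big_setD1 e eb)/= y'e.
  under eq_bigr => f fb do rewrite y'b//.
  rewrite big_split/= -mulr_sumr.
  have -> : \sum_(f in side b (inl k) :\ e) al f = delta - am by rewrite -alE; ring.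
  by rewrite /delta /sg; case: (sigma); ring.
have sumnb : \sum_(f in side (~~ b) (inl k)) y' f =
    \sum_(f in side (~~ b) (inl k)) y f - sg sigma * am.
  under eq_bigr => f fb do rewrite y'nb//.
  by rewrite sumrB -mulr_sumr beE.
have sumc c : \sum_(f in side c (inl k)) y' f =
    \sum_(f in side c (inl k)) y f - sg sigma * am.
  by case: (eqVneq c b) => [->//|cb]; have -> : c = ~~ b by move: cb; case: (c); case: (b).
exists y', kappa, am; split; split=> //.
(* Each coordinate moves from [y f] toward [x f] without passing it, so it stays nonnegative. *)
- move=> f; case: (eqVneq f e) => [->|fe].
    have := x_ge0 e; have := y0 e; move: zx yz; rewrite y'e /delta /sg.
    by case: (sigma); lra.
  rewrite ffunE (negPf fe); case: ifP => // _; have := kapP f.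
  rewrite le_max; have := x_ge0 f; have := y0 f; rewrite /sg.
  by case: (tau f) => yf xf /andP[k0 /orP[]] kf; lra.
- exact: sumc true.
- rewrite /balanced -ybal; apply/eqP; have := sumc true; have := sumc false.
  by rewrite /outflow /inflow /= => -> ->; ring.
- move=> f /[dup] fi; rewrite in_setD1 => /andP[/negPf fe finc]; split; last exact: kapP.
  by rewrite ffunE fe finc.
- rewrite -/delta -alE [am + _]addrC addrK.
  by apply: eq_bigr => f; rewrite /kappa in_setD1 => /andP[_ ->].
- rewrite -[RHS]beE; apply: eq_bigr => f fb; have := side_disjoint fb.
  by rewrite negbK /kappa => /negPf ->.
Qed.


(** * Lower bounds and finiteness of messages *)

Local Open Scope ereal_scope.

Definition local_value t k e y : \bar R :=
  node_fun (inl k) y +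
  \sum_(f in inc_edges (inl k) :\ e) message t (other_end (inl k) f) f (y f).

Lemma messageS t k e z : message t.+1 (inl k) e z =
  edge_fun e z + ereal_inf [set local_value t k e y
    | y in [set y : flow | (forall f, 0 <= y f)%R /\ y e = z]].
Proof. by []. Qed.

Lemma edge_fun_lower : exists2 C : R, (0 <= C)%R &
  forall e z, (- C)%:E <= edge_fun e z.
Proof.
exists (\sum_(e : edge) `|(1 - w) * cost e| * (capacity e)%:R)%R.
  by apply: sumr_ge0 => e _; rewrite mulr_ge0.
move=> e z; rewrite /edge_fun; case: ifP => [/andP[z0 zu]|]; last by rewrite leey.
rewrite lee_fin (bigD1 e)//= opprD.
have S0 : (0 <= \sum_(i | i != e) `|(1 - w) * cost i| * (capacity i)%:R)%R.
  by apply: sumr_ge0 => f _; rewrite mulr_ge0.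
have : (`|(1 - w) * cost e * z| <= `|(1 - w) * cost e| * (capacity e)%:R)%R.
  by rewrite normrM ler_wpM2l// ger0_norm.
by rewrite ler_norml => /andP[? _]; lra.
Qed.

Lemma node_fun_lower : exists2 C : R, (0 <= C)%R &
  forall k y, (forall e, 0 <= y e)%R -> (- C)%:E <= node_fun (inl k) y.
Proof.
exists (\sum_(k < nsrc N) `|w * penalty k 0|)%R; first exact: sumr_ge0.
move=> k y y0; rewrite /node_fun -[leLHS]add0e; apply: leeD.
  by rewrite /psi; case: ifP.
have S0 : (0 <= \sum_(i | i != k) `|w * penalty i 0|)%R by exact: sumr_ge0.
rewrite lee_fin (bigD1 k)//=.
have : (w * penalty k 0 <= w * penalty k (outflow y (inl k)))%R.
  rewrite ler_wpM2l ?(ltW (weight_gt0 N))//.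
  have := through_ge0 k y0; rewrite /through le_eqVlt => /orP[/eqP <-//|o0].
  by apply/ltW/(@penalty_incr _ N k); rewrite ?in_itv/= ?lexx// ltW.
have := ler_norm (- (w * penalty k 0))%R; rewrite normrN.
by move=> ? ?; lra.
Qed.

(** Uniformity in the argument lets the bound pass through the infimum. It excludes [-oo], so that
    sums of messages never mix the two infinities. *)
Lemma message_lower t : exists2 C : R, (0 <= C)%R &
  forall i e z, (- C)%:E <= message t i e z.
Proof.
have [C0 C00 C0P] := edge_fun_lower; have [C1 C10 C1P] := node_fun_lower.
elim: t => [|t [C C2 CP]].
  by exists C0 => // -[].
exists (C0 + (C1 + \sum_(e : edge) C))%R.
  by rewrite !addr_ge0// sumr_ge0.
move=> [k|j] e z; last first.
  apply: le_trans (C0P _ _); rewrite lee_fin lerN2 lerDl.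
  by rewrite !addr_ge0// sumr_ge0.
rewrite messageS opprD EFinD; apply: leeD; first exact: C0P.
apply: le_ereal_inf_tmp => _ [y [y0 _] <-].
rewrite opprD EFinD; apply: leeD; first exact: C1P.
apply: (@le_trans _ _ (\sum_(f in inc_edges (inl k) :\ e) (- C)%:E)); last exact: lee_sum.
rewrite sumEFin lee_fin sumrN lerN2 [leRHS](bigID (mem (inc_edges (inl k) :\ e)))/=.
by rewrite lerDl sumr_ge0.
Qed.

Lemma message_neqNy t i e z : message t i e z != -oo.
Proof.
have [C _ CP] := message_lower t; rewrite -ltNye.
by apply: lt_le_trans (CP i e z); rewrite ltNyr.
Qed.

Lemma message_out t i e z : ~~ (0 <= z <= (capacity e)%:R)%R -> message t i e z = +oo.
Proof.
move=> /negPf zo; have eo : edge_fun e z = +oo by rewrite /edge_fun zo.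
case: t i => [|t] [k|j] //; rewrite messageS eo addye//.
have := message_neqNy t.+1 (inl k) e z; rewrite messageS eo.
by apply: contraNneq => ->.
Qed.

Lemma message_lty t i e : message t i e (x e) < +oo.
Proof.
have edge_lt f : edge_fun f (x f) < +oo.
  by rewrite /edge_fun; have [_ /(_ f) ->] := x_feasible; rewrite ltry.
elim: t i e => [|t IH] [k|j] e //; try exact: edge_lt.
rewrite messageS lte_add_pinfty//; apply: (@le_lt_trans _ _ (local_value t k e x)).
  by apply: ereal_inf_lbound; exists x => //; split => // f; exact: x_ge0.
rewrite /local_value lte_add_pinfty//.
  rewrite /node_fun /psi; have [/(_ k) -> _] := x_feasible.
  by rewrite eqxx add0e ltry.
by apply: lte_sum_pinfty => f _; exact: IH.
Qed.

Lemma local_value_finite t k e y : local_value t k e y < +oo ->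
  balanced y k /\
  forall f, f \in inc_edges (inl k) :\ e -> (0 <= y f <= (capacity f)%:R)%R.
Proof.
rewrite /local_value => fin.
have sNy : \sum_(f in inc_edges (inl k) :\ e)
    message t (other_end (inl k) f) f (y f) != -oo.
  by apply/eqP => /esum_eqNyP [f [_ _ /eqP]]; apply/negP; exact: message_neqNy.
have nNy : node_fun (inl k) y != -oo by rewrite /node_fun /psi; case: ifP.
split.
  apply: contraLR fin; rewrite /node_fun /psi /balanced => /negPf ->.
  by rewrite -addeA addye ?ltxx// adde_eq_ninfty negb_or sNy.
move=> f fi; apply: contraLR fin => yo.
have -> : \sum_(f in inc_edges (inl k) :\ e)
    message t (other_end (inl k) f) f (y f) = +oo.
  apply/eqP; rewrite esum_eqy; last by move=> *; exact: message_neqNy.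
  by apply/existsP; exists f; rewrite fi message_out.
by rewrite addey ?ltxx.
Qed.

(* Slopes of messages against costs of walks *)
Local Close Scope ereal_scope.

Definition cost_bound t o a (B : R) := forall p, path (follows tip o) a p ->
  all avail p -> (t <= size p)%N \/ ahead tip o (last a p) = None ->
  B <= \sum_(d <- a :: p) slope d.

Lemma cost_boundS t o a B : cost_bound t o a B -> cost_bound t.+1 o a B.
Proof.
by move=> aB p fp ap [tp|pN]; apply: aB => //; [left; exact: ltnW | right].
Qed.

Lemma cost_bound_follows t o a d B : cost_bound t.+1 o a B ->
  follows tip o a d -> avail d -> cost_bound t o d (B - slope a).
Proof.
move=> aB ad vd p fp ap hp; rewrite lerBlDl; have := aB (d :: p).
rewrite big_cons; apply => /=.
- by rewrite ad.
- by rewrite vd.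
- by case: hp => [tp|pN]; [left | right].
Qed.

Lemma ahead_edge e b sigma :
  ahead tip (sigma (+) b) (inl e, sigma) = junction (endn e b) b.
Proof. by case: sigma; case: b. Qed.

Lemma atail_edge e b sigma :
  atail tip (sigma (+) b) (inl e, sigma) = junction (endn e (~~ b)) (~~ b).
Proof. by case: sigma; case: b. Qed.

Lemma edge_slope e z z' sigma B :
  B <= slope (inl e, sigma) -> 0 <= z <= (capacity e)%:R ->
  0 <= z' <= (capacity e)%:R -> 0 <= sg sigma * (z - z') ->
  (edge_fun e z' + (B * (sg sigma * (z - z')))%:E <= edge_fun e z)%E.
Proof.
move=> Ba zu z'u zz; rewrite /edge_fun zu z'u -EFinD lee_fin.
apply: le_trans (lerD (lexx _) (ler_wpM2r zz Ba)) _.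
by rewrite le_eqVlt; apply/orP; left; apply/eqP; rewrite /slope /sg; case: ifP => _; ring.
Qed.

(** For [am > 0] the throughput of [y] deviates in direction [sigma], so the arc is residual, and
    the second clause of [directional_slope] applies between the distances [D - am] and [D]. *)
Lemma penalty_slope k y sigma am : (forall f, 0 <= y f) ->
  0 <= am <= Num.max (sg sigma * (through y k - through x k)) 0 ->
  w * penalty k (through y k - sg sigma * am) + slope (inr k, sigma) * am <=
  w * penalty k (through y k).
Proof.
move=> y0 /andP[am0 amD].
have [->|amn0] := eqVneq am 0; first by rewrite !mulr0 subr0 addr0.
have {}am0 : 0 < am by rewrite lt_neqAle eq_sym amn0.
set D := sg sigma * (through y k - through x k) in amD.
have {}amD : am <= D by move: amD; rewrite le_max => /orP[//|]; rewrite leNgt am0.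
have yD : through y k = through x k + sg sigma * D.
  by rewrite /D /sg; case: ifP => _; ring.
have av : avail (inr k, sigma).
  rewrite /=; case: (sigma) yD => //=; rewrite /sg => yD.
  by have := through_ge0 k y0; lra.
have [_ /(_ (D - am) D)] := dphiP av; rewrite -yD through_ge0// => H.
rewrite /= -mulrA -mulrDr ler_wpM2l ?(ltW (weight_gt0 N))//.
have -> : through y k - sg sigma * am = through x k + sg sigma * (D - am).
  by rewrite yD; ring.
by have := H _ isT; rewrite subKr; apply; rewrite subr_ge0 amD gerBl ltW.
Qed.

(* A deviation of sign [sigma] on [e], sent into the end [b] of [e], propagates
   along walks of orientation [sigma (+) b]. *)
Lemma message_slope t e b sigma B z z' :
  cost_bound t (sigma (+) b) (inl e, sigma) B -> 0 <= z <= (capacity e)%:R ->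
  0 <= sg sigma * (z' - x e) -> 0 <= sg sigma * (z - z') ->
  (message t (endn e b) e z' + (B * (sg sigma * (z - z')))%:E <=
   message t (endn e b) e z)%E.
Proof.
elim: t e b sigma B z z' => [|t IH] e b sigma B z z' aB zu zx zz.
  rewrite /=; apply: edge_slope => //; last first.
    have [_ /(_ e)] := x_feasible; move: zu zx zz; rewrite /sg.
    by case: ifP => _ /andP[? ?] ? ? /andP[? ?]; apply/andP; split; lra.
  by have := aB [::] isT isT (or_introl (leqnn _)); rewrite big_seq1.
have z'u : 0 <= z' <= (capacity e)%:R.
  have [_ /(_ e)] := x_feasible; move: zu zx zz; rewrite /sg.
  by case: ifP => _ /andP[? ?] ? ? /andP[? ?]; apply/andP; split; lra.
set a := (inl e, sigma) in aB *.
(* At a destination the walk consisting of [a] alone already reaches the ground, so [B] is at most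
   its slope. *)
case E : (endn e b) => [k|j]; last first.
  apply: edge_slope => //.
  have := aB [::] isT isT; rewrite big_seq1; apply; right.
  by rewrite /= ahead_edge E.
have eb : e \in side b (inl k) by rewrite mem_side E.
rewrite !messageS; set o := sigma (+) b in aB.
set delta := sg sigma * (z - z').
have -> : (B * delta)%:E = ((slope a * delta)%:E + ((B - slope a) * delta)%:E)%E.
  by rewrite -EFinD; congr _%:E; ring.
rewrite addeACA; apply: leeD; first exact: edge_slope.
apply: le_ereal_inf_tmp => _ [y [y0 ye] <-].
have [->|/negP fin] := eqVneq (local_value t k e y) +oo%E; first exact: leey.
move/negP: fin; rewrite -ltey => /local_value_finite[ybal yu].
have [|y' [kappa [am]]] := redistribute eb y0 ybal zx; first by rewrite ye.
rewrite ye -/delta => -[[y'e y'0 y'k y'bal] [am0 kP sumb sumnb]].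
apply: (@le_trans _ _ (local_value t k e y' + ((B - slope a) * delta)%:E)%E).
  by apply: leeD => //; apply: ereal_inf_lbound; exists y'.
set m := (inr k, sigma) : split_arc * bool.
(* Edges on the side of [e] continue the walk right after [a]; those on the other side are reached
   through [m], whose slope is paid as well. *)
pose gam f := (if f \in side b (inl k) then B - slope a else B - slope a - slope m) * kappa f.
have -> : ((B - slope a) * delta)%:E =
    ((slope m * am)%:E + \sum_(f in inc_edges (inl k) :\ e) (gam f)%:E)%E.
  rewrite sumEFin -EFinD; congr _%:E.
  have -> : \sum_(f in inc_edges (inl k) :\ e) gam f =
      \sum_(f in side b (inl k) :\ e) gam f + \sum_(f in side (~~ b) (inl k)) gam f.
    exact: sum_inc.
  have -> : \sum_(f in side b (inl k) :\ e) gam f = (B - slope a) * (delta - am).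
    rewrite -sumb mulr_sumr; apply: eq_bigr => f; rewrite in_setD1 /gam => /andP[_ ->] //.
  have -> : \sum_(f in side (~~ b) (inl k)) gam f = (B - slope a - slope m) * am.
    rewrite -sumnb mulr_sumr; apply: eq_bigr => f fb.
    by have := side_disjoint fb; rewrite negbK /gam => /negPf ->.
  by ring.
rewrite /local_value addeACA; apply: leeD.
  rewrite /node_fun /psi; move: ybal y'bal; rewrite /balanced => -> ->.
  rewrite !add0e -EFinD lee_fin -/(through y k) -/(through y' k) y'k.
  exact: penalty_slope.
rewrite -big_split /=; apply: lee_sum => f fi.
have [y'f /andP[k0 kD]] := kP f fi.
set tau := sigma (+) (f \in side b (inl k)) in y'f kD.
have [kf0|kfn0] := eqVneq (kappa f) 0.
  by rewrite y'f /gam kf0 !mulr0 subr0 adde0.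
have {}k0 : 0 < kappa f by rewrite lt_neqAle eq_sym kfn0.
have {}kD : kappa f <= sg tau * (y f - x f).
  by move: kD; rewrite le_max => /orP[//|]; rewrite leNgt k0.
have /andP[yf0 yfu] := yu f fi.
have sgsg (h : R) : sg tau * (sg tau * h) = h by rewrite /sg; case: ifP => _; ring.
(* The value [y f] is within capacity and strictly beyond [x f] in direction [tau], so [x f] has
   room there. *)
have vf : avail (inl f, tau).
  by move: kD; rewrite /= /sg; case: (tau) => kD; lra.
have hz : sg tau * (y f - y' f) = kappa f.
  by rewrite y'f opprB addrC subrK sgsg.
have hx : 0 <= sg tau * (y' f - x f).
  have -> : sg tau * (y' f - x f) = sg tau * (y f - x f) - kappa f.
    by rewrite -[in RHS]hz; ring.
  by rewrite subr_ge0.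
have ef : (inl f : split_arc) != (inl e : split_arc).
  by move: fi; rewrite in_setD1 => /andP[].
rewrite /gam -[in X in (_ + X)%E]hz.
case: (boolP (f \in side b (inl k))) => fb.
  rewrite (other_endE fb).
  have tauE : tau = ~~ sigma by rewrite /tau fb addbT.
  have oE : o = tau (+) ~~ b by rewrite tauE /o; case: (sigma); case: (b).
  apply: IH => //; rewrite ?hz ?yf0// ?ltW// -oE.
  apply: (cost_bound_follows aB) => //.
  rewrite /follows ahead_edge oE atail_edge negbK E ef.
  by move: fb; rewrite mem_side => /eqP ->; rewrite eqxx.
have {}fb : f \in side (~~ b) (inl k).
  move: fi; rewrite (inc_sides eb) finset.in_setU => /orP[|//].
  by rewrite in_setD1 (negPf fb) andbF.
have tauE : tau = sigma.
  by have := side_disjoint fb; rewrite negbK /tau => /negPf ->; rewrite addbF.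
rewrite (other_endE fb) negbK.
have vm : avail m.
  have am1 : 0 < am.
    rewrite -sumnb (bigD1 f)//= ltr_pwDl// sumr_ge0// => g /andP[gb _].
    have [|_ /andP[]//] := kP g.
    by rewrite (inc_sides eb) finset.in_setU gb orbT.
  have := am0; rewrite le_max => /andP[_ /orP[|]]; last by rewrite leNgt am1.
  have := through_ge0 k y0; rewrite /= /sg; case: (sigma) => //= ? ?; lra.
apply: IH => //; rewrite ?hz ?yf0// ?ltW//.
rewrite tauE -/o.
(* One iteration covers the two arcs [m] and [inl f]; [cost_boundS] gives back the unit of length
   spent on [m]. *)
apply: (cost_bound_follows (cost_boundS (cost_bound_follows aB _ vm))) => //.
- by rewrite /follows ahead_edge E /o /atail /=; case: (sigma); case: (b); rewrite /= eqxx.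
- rewrite /follows /o atail_edge; move: fb; rewrite mem_side => /eqP ->.
  rewrite /ahead /m /=.
  have -> : (sigma == sigma (+) b) = ~~ b by case: (sigma); case: (b).
  by rewrite eqxx.
- by rewrite -tauE.
Qed.

(** Away from [x e] the two messages grow at rates at least [B true] and [B false]. The belief
    subtracts one copy of [edge_fun], whose rate is [slope a], strictly below their sum. *)
Lemma belief_lt : exists T : nat, forall t, (T <= t)%N -> forall e z,
  z != x e -> (belief t e (x e) < belief t e z)%E.
Proof.
have [T TP] := walk_cost_bounds (None : split_node) residual_cycle_gt0 slope_back_ge0.
exists T => t Tt e z zx.
have xu : 0 <= x e <= (capacity e)%:R by have [_ /(_ e)] := x_feasible.
have mfin b : message t (endn e b) e (x e) \is a fin_num.
  by rewrite fin_numE message_neqNy lt_eqF ?message_lty.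
have [m1 m1E] : exists m1, message t (esrc e) e (x e) = m1%:E.
  by exists (fine (message t (esrc e) e (x e))); rewrite fineK// (mfin true).
have [m2 m2E] : exists m2, message t (edst e) e (x e) = m2%:E.
  by exists (fine (message t (edst e) e (x e))); rewrite fineK// (mfin false).
rewrite /belief xu m1E m2E /edge_fun xu -EFinN -!EFinD.
case: ifPn => zu; last by rewrite ltry.
rewrite zu.
pose sigma := x e < z; pose delta := sg sigma * (z - x e).
have d0 : 0 < delta.
  rewrite /delta /sigma /sg; move: zx; rewrite neq_lt => /orP[zl|zl].
    have /negPf -> : ~~ (x e < z) by rewrite -leNgt ltW.
    by lra.
  by rewrite zl; lra.
have va : avail (inl e, sigma).
  by move: d0; rewrite /delta /sg /=; case: (sigma) => ?; lra.
have [B Ba BP] := TP t Tt (inl e, sigma) va.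
have slopeM b : (message t (endn e b) e (x e) + (B (sigma (+) b) * delta)%:E <=
    message t (endn e b) e z)%E.
  apply: message_slope => //; rewrite ?subrr ?mulr0//; first exact: BP.
  exact: ltW.
have := slopeM true; have := slopeM false; rewrite /endn m1E m2E => h2 h1.
apply: lt_le_trans (leeD (leeD h1 h2) (lexx _)).
rewrite -EFinN -!EFinD lte_fin.
have BB : B (sigma (+) true) + B (sigma (+) false) = B true + B false.
  by case: (sigma) => //=; exact: addrC.
have : slope (inl e, sigma) * delta < (B true + B false) * delta by rewrite ltr_pM2r.
rewrite -BB /=.
have -> : sg sigma * ((1 - w) * cost e) * delta = (1 - w) * cost e * (z - x e).
  by rewrite /delta /sg; case: ifP => _; ring.
lra.
Qed.

End SplitGraph.

Theorem proposition2 (R : realType) (N : network R)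
    (feasible_nonempty : exists x : {ffun edge_of (edges N) -> R}, feasible x)
    (x : {ffun edge_of (edges N) -> R})
    (x_unique_optimal : unique_optimal x) :
  exists T : nat, forall t : nat, (T <= t)%N ->
    forall e : edge_of (edges N), argmin (belief t e) = [set x e].
Proof.
have x0 k : 0 <= through x k by apply: through_ge0 => e; exact: x_ge0.
have slopes (a : 'I_(nsrc N) * bool) : exists c, avail x (inr a.1, a.2) ->
    directional_slope (penalty a.1) (through x a.1) a.2 c.
  (* Where the arc is not residual the slope [0] is a placeholder. *)
  case: (boolP (avail x (inr a.1, a.2))) => [av|_]; last by exists 0.
  have [c cP] := exists_slope (@penalty_convex _ N a.1) (@penalty_pwl _ N a.1) (x0 a.1) av.
  by exists c.
have [dphi dphiP] := boolp.choice slopes.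
have [T TP] := belief_lt x_unique_optimal (fun k sigma => dphiP (k, sigma)).
exists T => t Tt e; apply/seteqP; split=> [z /= zmin|_ -> z].
  by apply/eqP; apply: contraT => /(TP t Tt e); rewrite ltNge zmin.
by have [->//|/(TP t Tt e)/ltW] := eqVneq z (x e).
Qed.
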